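(* Let $\rho\in(0,1)$ and, for each $n$, let $(X_1,\ldots,X_n)$ be jointly normal with unit variances and $\operatorname{Corr}(X_i,X_j)=\rho$ for all $i\ne j$. Then, for any $\alpha\in(0,1)$, $$\lim_{n\to\infty}FWER_{Hommel}(n,\alpha,\rho)=0$$ under the global null hypothesis.
   Context: Testing problem: $X_i\sim\mathcal N(\mu_i,1)$; test $H_{0i}:\mu_i=0$ against $H_{1i}:\mu_i>0$, $1\le i\le n$. The global null hypothesis states that $\mu_i=0$ for all $i$. The p-values are $P_i=1-\Phi(X_i)$, with $\Phi$ the standard normal distribution function, and $P_{(1)}\le\cdots\le P_{(n)}$ are the ordered p-values. For a multiple testing procedure $T$, $V_n(T)$ is the number of type I errors (rejected true nulls), and $FWER_T(n,\alpha,\rho)=\mathbb P(V_n(T)\ge1)$, the probability being computed under the equicorrelated model with correlation $\rho$. Hommel's procedure at level $\alpha$: Step 1. Compute $j=\max\{i\in\{1,\ldots,n\}:P_{(n-i+k)}>k\alpha/i\text{ for } k=1,\ldots,i\}$. Step 2. If the maximum in Step 1 does not exist, reject all the hypotheses; otherwise reject all $H_{0i}$ with $P_i\le\alpha/j$. *)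

(* Defs.v *)
From HB Require Import structures.
From mathcomp Require Import all_boot all_order all_algebra.
From mathcomp Require Import all_classical all_reals all_analysis.

Set Implicit Arguments.
Unset Strict Implicit.
Unset Printing Implicit Defensive.

Import Order.TTheory GRing.Theory Num.Theory.
Import numFieldNormedType.Exports.

Local Open Scope classical_set_scope.
Local Open Scope ring_scope.

Section normal_vectors.
Context {R : realType}.

(* The law N(m, s^2), degenerate case included: the library's [normal_prob m 0]
   is a default value (a uniform law), not the point mass at m. *)
Definition normal_law (m s : R) : set R -> \bar R :=
  if s == 0 then \d_m else normal_prob m s.

(* Every linear combination of the coordinates is univariate normal, possibly
   degenerate. *)
Definition jointly_normal {d : measure_display} {Omega : measurableType d}
    (P : probability Omega R) {n : nat} (X : 'I_n -> {RV P >-> R}) : Prop :=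
  forall c : 'I_n -> R, exists m s : R, forall A : set R, measurable A ->
    P ((fun w => \sum_(i < n) c i * X i w) @^-1` A) = normal_law m s A.

Definition correlation {d : measure_display} {Omega : measurableType d}
    (P : probability Omega R) (X Y : {RV P >-> R}) : R :=
  fine (covariance P X Y) /
    (Num.sqrt (fine (variance P X)) * Num.sqrt (fine (variance P Y))).

Definition equicorrelated_normal {d : measure_display}
    {Omega : measurableType d} (P : probability Omega R) {n : nat}
    (mu : 'I_n -> R) (rho : R) (X : 'I_n -> {RV P >-> R}) : Prop :=
  [/\ jointly_normal X,
      forall i, expectation P (X i) = (mu i)%:E,
      forall i, variance P (X i) = 1%:E &
      forall i j, i != j -> correlation (X i) (X j) = rho].

End normal_vectors.

Section multiple_testing.
Context {R : realType}.

Definition Phi (x : R) : R := fine (normal_prob 0 1 `]-oo, x]).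

Definition pvalue (x : R) : R := 1 - Phi x.

(* P_(k), the k-th smallest p-value, for 1 <= k <= n. *)
Definition ordered_pvalue {n : nat} (p : 'I_n -> R) (k : nat) : R :=
  nth 0 (sort <=%R [seq p i | i <- enum 'I_n]) k.-1.

(* Maps the level and the p-values to the set of rejected hypotheses. *)
Definition procedure (n : nat) := R -> ('I_n -> R) -> {set 'I_n}.

(* V_n: the null H_0i : mu_i = 0 is true and rejected. *)
Definition type1_errors {n : nat} (mu : 'I_n -> R) (rejected : {set 'I_n}) :
  nat := #|[set i in rejected | mu i == 0]%SET|.

Definition FWER {d : measure_display} {Omega : measurableType d}
    (P : probability Omega R) {n : nat} (mu : 'I_n -> R)
    (X : 'I_n -> {RV P >-> R}) (T : procedure n) (alpha : R) : \bar R :=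
  P [set w | (1 <= type1_errors mu (T alpha (fun i => pvalue (X i w))))%N].

(* The indices i in {1, ..., n} with P_(n-i+k) > k alpha / i for k = 1, ..., i. *)
Definition hommel_indices (n : nat) (alpha : R) (p : 'I_n -> R) : seq nat :=
  [seq i <- iota 1 n |
    all (fun k => k%:R * alpha / i%:R < ordered_pvalue p (n - i + k)%N)
        (iota 1 i)].

Definition hommel (n : nat) : procedure n := fun alpha p =>
  let J := hommel_indices alpha p in
  if J is [::] then [set: 'I_n]%SET
  else [set i | p i <= alpha / (\max_(j <- J) j)%N%:R]%SET.

End multiple_testing.

(* Main.v *)
(* Hommel's index [j] is at least the number [N] of p-values above [alpha], so a
   rejection needs some p-value at most [alpha / N].  It suffices that [N >= n / B]
   and that the smallest p-value exceeds [alpha * B / n], both with probability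
   close to 1 for a large constant [B].

   Write [X_i = M + Y_i] with [M] the mean of the [X_i].  All that is used about
   joint normality is the formula [E exp L = exp (Var L / 2)] for linear
   combinations [L] of the [X_i].  Chernoff's bound gives [M < K] off a small event.
   Since [Var Y_i <= 1 - rho < 1], a union bound shows that no [Y_i] comes within
   [K] of the threshold [sqrt (2 log n)] at which a p-value drops to order [1 / n].
   Since [Cov (Y_i, Y_j) <= 0] for [i != j], the empirical mean of [exp (- l * Y_i)]
   has variance [O(1 / n)], so it exceeds half of its expectation; as the empirical
   mean of [exp (- 2 * l * Y_i)] is bounded, a Paley-Zygmund argument with [l] large
   produces a positive proportion of indices with [Y_i < z - K], hence [X_i < z],
   where [z] has p-value above [alpha]. *)

From HB Require Import structures.
Require Import Defs.
From mathcomp Require Import all_boot all_order all_algebra.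
From mathcomp Require Import all_classical all_reals all_analysis measurable_realfun.
From mathcomp Require Import ring lra zify.

Set Implicit Arguments.
Unset Strict Implicit.
Unset Printing Implicit Defensive.

Import Order.TTheory GRing.Theory Num.Theory.
Import numFieldNormedType.Exports.

Local Open Scope classical_set_scope.
Local Open Scope ring_scope.

(** * Normal laws *)

Section normal_moments.
Context {R : realType}.
Implicit Types m s t x : R.
Local Notation mu := (@lebesgue_measure R).

(** The abstract Radon-Nikodym derivative agrees almost everywhere with [normal_pdf], since both
    have the same integral over every measurable set. *)
Lemma ge0_integral_normal_prob m s (f : R -> \bar R) :
  measurable_fun setT f -> (forall x, (0 <= f x)%E) ->
  (\int[normal_prob m s]_x f x = \int[mu]_x (f x * (normal_pdf m s x)%:E))%E.
Proof.
move=> mf f0.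
have dom := normal_prob_dominates m s.
rewrite -(Radon_Nikodym_SigmaFinite.change_of_variables dom)//.
have mpdf : measurable_fun [set: R] (fun x => (normal_pdf m s x)%:E).
  by apply/measurable_EFinP; exact: measurable_normal_pdf.
have irn := Radon_Nikodym_SigmaFinite.f_integrable dom.
apply: ae_eq_integral => //.
- by apply: emeasurable_funM => //; exact: measurable_int irn.
- exact: emeasurable_funM.
- apply: ae_eqe_mul2l; apply: integral_ae_eq => //= E _ mE.
  by rewrite -Radon_Nikodym_SigmaFinite.f_integral.
Qed.

(** Completing the square in the exponent; integration then gives the moment generating function. *)
Lemma normal_pdf_tilt m s t x : s != 0 ->
  expR (t * x) * normal_pdf m s x =
  expR (t * m + t ^+ 2 * s ^+ 2 / 2) * normal_pdf (m + t * s ^+ 2) s x.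
Proof.
move=> s0; rewrite !normal_pdfE// /normal_fun !(mulrCA (expR _)) -!expRD.
by congr (_ * expR _); field.
Qed.

Lemma normal_prob_mgf m s t : s != 0 ->
  (\int[normal_prob m s]_x (expR (t * x))%:E =
   (expR (t * m + t ^+ 2 * s ^+ 2 / 2))%:E)%E.
Proof.
move=> s0; rewrite ge0_integral_normal_prob; last 2 first.
- apply/measurable_EFinP; apply: measurableT_comp => //.
- by move=> x; rewrite lee_fin expR_ge0.
under eq_integral do rewrite -EFinM normal_pdf_tilt// EFinM.
rewrite ge0_integralZl//.
- by rewrite integral_normal_pdf mule1.
- by apply/measurable_EFinP; exact: measurable_normal_pdf.
- by move=> x _; rewrite lee_fin normal_pdf_ge0.
Qed.

(** The right side is [normal_pdf 0 s x * expR (- k * x ^+ 2)] with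
    [k = (r ^- 2 - 1) / (2 * s ^+ 2)], and the exponential lies above its tangent at 0. Integrated
    for [r] near 1, this yields the second moment without integration by parts. *)
Lemma normal_pdf_rescale s r x : 0 < s -> 0 < r ->
  normal_pdf 0 s x * (1 - (r ^- 2 - 1) / (2 * s ^+ 2) * x ^+ 2) <=
  r * normal_pdf 0 (s * r) x.
Proof.
move=> s0 r0; rewrite !normal_pdfE ?mulf_neq0 ?gt_eqF// /normal_peak /normal_fun.
have -> : r * ((Num.sqrt ((s * r) ^+ 2 * pi *+ 2))^-1 *
    expR (- (x - 0) ^+ 2 / ((s * r) ^+ 2 *+ 2))) =
    (Num.sqrt (s ^+ 2 * pi *+ 2))^-1 * expR (- (x - 0) ^+ 2 / (s ^+ 2 *+ 2)) *
    expR (- ((r ^- 2 - 1) / (2 * s ^+ 2) * x ^+ 2)).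
  rewrite -[RHS]mulrA -expRD mulrA; congr (_ * expR _).
    have -> : (s * r) ^+ 2 * pi *+ 2 = r ^+ 2 * (s ^+ 2 * pi *+ 2).
      by ring.
    by rewrite sqrtrM ?sqr_ge0// sqrtr_sqr gtr0_norm// invfM mulVKf// gt_eqF.
  by field; rewrite !gt_eqF.
apply: ler_wpM2l; last exact: expR_ge1Dx.
by rewrite mulr_ge0 ?expR_ge0// invr_ge0 sqrtr_ge0.
Qed.

Lemma normal_pdf_rescale_ler s r x : 0 < s -> 0 < r ->
  normal_pdf 0 s x <= r * normal_pdf 0 (s * r) x +
    (r ^- 2 - 1) / (2 * s ^+ 2) * (x ^+ 2 * normal_pdf 0 s x).
Proof.
move=> s0 r0; rewrite -lerBlDr (le_trans _ (normal_pdf_rescale x s0 r0))//.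
by rewrite le_eqVlt; apply/orP; left; apply/eqP; ring.
Qed.

Lemma normal_pdf_rescale_gel s r x : 0 < s -> 0 < r ->
  normal_pdf 0 s x + (1 - r ^- 2) / (2 * s ^+ 2) * (x ^+ 2 * normal_pdf 0 s x)
  <= r * normal_pdf 0 (s * r) x.
Proof.
move=> s0 r0; rewrite (le_trans _ (normal_pdf_rescale x s0 r0))//.
by rewrite le_eqVlt; apply/orP; left; apply/eqP; ring.
Qed.

Lemma normal_pdf_norm m s : normal_pdf m `|s| = normal_pdf m s.
Proof.
apply/funext => x.
by rewrite /normal_pdf normr_eq0 /normal_peak /normal_fun real_normK ?num_real.
Qed.

Lemma normal_prob_sqr s : s != 0 ->
  (\int[normal_prob 0%R s]_x (x ^+ 2)%:E = (s ^+ 2)%:E)%E.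
Proof.
rewrite -normr_gt0 -(real_normK (num_real s)) => s0.
rewrite ge0_integral_normal_prob; last 2 first.
- by apply/measurable_EFinP; exact: measurable_funX.
- by move=> x; rewrite lee_fin sqr_ge0.
rewrite -normal_pdf_norm; move: `|s| s0 => {}s s0.
set v := (\int[mu]_x _)%E.
have mp s' : measurable_fun [set: R] (fun x => (normal_pdf 0 s' x)%:E).
  by apply/measurable_EFinP; exact: measurable_normal_pdf.
have mx2 : measurable_fun [set: R] (fun x : R => (x ^+ 2)%:E * (normal_pdf 0 s x)%:E)%E.
  by apply: emeasurable_funM => //; apply/measurable_EFinP; exact: measurable_funX.
have x20 x : (0 <= (x ^+ 2)%:E * (normal_pdf 0 s x)%:E)%E.
  by rewrite -EFinM lee_fin mulr_ge0 ?sqr_ge0 ?normal_pdf_ge0.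
have v0 : (0 <= v)%E by apply: integral_ge0 => x _.
(* [lo] and [hi] integrate the rescaling inequality for [r < 1] and for [r > 1]. The two
   arrangements keep all terms nonnegative, so [v] may still be infinite here. *)
have lo r : 0 < r -> r < 1 ->
    (1 <= r%:E + ((r ^- 2 - 1) / (2 * s ^+ 2))%:E * v)%E.
  move=> r0 r1; rewrite -(integral_normal_pdf 0 s).
  have mps := mp s; have mpr := mp (s * r).
  have k0 : 0 <= (r ^- 2 - 1) / (2 * s ^+ 2).
    apply: divr_ge0; last by rewrite mulr_ge0 ?sqr_ge0.
    rewrite subr_ge0 invf_ge1 ?exprn_gt0//.
    by rewrite expr_le1 ?ltW.
  rewrite -[X in (_ <= X%:E + _)%E]mulr1 (EFinM r 1) -(integral_normal_pdf 0 (s * r)).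
  rewrite /v -!ge0_integralZl//; last 2 first.
  - by move=> x _; rewrite lee_fin normal_pdf_ge0.
  - by rewrite lee_fin ltW.
  rewrite -ge0_integralD//; last 4 first.
  - by move=> x _; rewrite -EFinM lee_fin mulr_ge0 ?normal_pdf_ge0// ltW.
  - exact: measurable_funeM.
  - by move=> x _; rewrite mule_ge0.
  - exact: measurable_funeM.
  apply: ge0_le_integral => //.
  - by move=> x _; rewrite lee_fin normal_pdf_ge0.
  - by apply: emeasurable_funD; exact: measurable_funeM.
  - move=> x _; rewrite -!EFinM -EFinD lee_fin.
    exact: normal_pdf_rescale_ler.
have hi r : 1 < r ->
    (1 + ((1 - r ^- 2) / (2 * s ^+ 2))%:E * v <= r%:E)%E.
  move=> {lo} r1; have r0 : 0 < r by rewrite (lt_trans _ r1).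
  have r0E : (0 <= r%:E)%E by rewrite lee_fin ltW.
  rewrite -[X in (X + _ <= _)%E](integral_normal_pdf 0 s).
  have mps := mp s; have mpr := mp (s * r).
  have k0 : 0 <= (1 - r ^- 2) / (2 * s ^+ 2).
    apply: divr_ge0; last by rewrite mulr_ge0 ?sqr_ge0.
    rewrite subr_ge0 invf_le1 ?exprn_gt0//.
    by rewrite expr_ge1 ?ltW.
  have -> : (r%:E = \int[mu]_x (r%:E * (normal_pdf 0 (s * r) x)%:E))%E.
    rewrite ge0_integralZl//; first by rewrite integral_normal_pdf mule1.
    by move=> x _; rewrite lee_fin normal_pdf_ge0.
  rewrite /v -[X in (_ + X <= _)%E]ge0_integralZl; [|by []..].
  rewrite -ge0_integralD; last 5 first.
  - by [].
  - by move=> x _; rewrite lee_fin normal_pdf_ge0.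
  - by [].
  - by move=> x _; rewrite mule_ge0.
  - exact: measurable_funeM.
  apply: ge0_le_integral => //.
  - by move=> x _; apply: adde_ge0; [rewrite lee_fin normal_pdf_ge0|rewrite mule_ge0].
  - by apply: emeasurable_funD => //; exact: measurable_funeM.
  - exact: measurable_funeM.
  - move=> x _; rewrite -!EFinM -EFinD lee_fin.
    exact: normal_pdf_rescale_gel.
case: v v0 lo hi {mx2 x20} => [v| |]// v0 lo hi; last first.
  (* An infinite [v] contradicts [hi] at [r = 2]. *)
  have := hi 2%R ltac:(lra); rewrite gt0_muley ?leye_eq// lte_fin.
  by rewrite divr_gt0 ?mulr_gt0 ?exprn_gt0//; lra.
have s20 : 0 < s ^+ 2 by rewrite exprn_gt0.
(* The upper bound takes [r = 1 + q], the lower one [r = 1 - q]; as [3 * s ^+ 2 * q <= e], the error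
   is at most [e]. *)
congr EFin; apply/eqP; rewrite eq_le; apply/andP; split; apply/ler_addgt0Pr => e e0;
  set q := e / (3 * s ^+ 2 + e); have qD : 0 < 3 * s ^+ 2 + e by lra.
- have q0 : 0 < q by rewrite divr_gt0.
  have q1 : q < 1 by rewrite ltr_pdivrMr//; lra.
  have qE : q * (3 * s ^+ 2 + e) = e by rewrite divfK// gt_eqF.
  have := hi (1 + q) ltac:(lra); rewrite -EFinM -EFinD lee_fin.
  have -> : 1 + (1 - (1 + q) ^- 2) / (2 * s ^+ 2) * v =
      1 + q * ((2 + q) * v / (2 * s ^+ 2 * (1 + q) ^+ 2)).
    by field; rewrite !gt_eqF//; lra.
  rewrite lerD2l ger_pMr// ler_pdivrMr; last first.
    by rewrite !mulr_gt0 ?exprn_gt0//; lra.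
  rewrite lee_fin in v0; nra.
- have q0 : 0 < q by rewrite divr_gt0.
  have q1 : q < 1 by rewrite ltr_pdivrMr//; lra.
  have qE : q * (3 * s ^+ 2 + e) = e by rewrite divfK// gt_eqF.
  have := lo (1 - q) ltac:(lra) ltac:(lra); rewrite -EFinM -EFinD lee_fin.
  have -> : 1 - q + ((1 - q) ^- 2 - 1) / (2 * s ^+ 2) * v =
      1 - q * (1 - (2 - q) * v / (2 * s ^+ 2 * (1 - q) ^+ 2)).
    by field; rewrite !gt_eqF//; lra.
  rewrite lerBrDl gerDr pmulr_rle0// subr_le0 ler_pdivlMr; last first.
    by rewrite !mulr_gt0 ?exprn_gt0//; lra.
  rewrite lee_fin in v0; nra.
Qed.

End normal_moments.

Section normal_random_variable.
Context {R : realType} {d : measure_display} {Omega : measurableType d}.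
Context {P : probability Omega R} (L : {RV P >-> R}) (m s : R).
Hypothesis hL : forall A : set R, measurable A ->
  P (L @^-1` A) = normal_law m s A.

Lemma ge0_integral_normal_rv (f : R -> \bar R) :
  measurable_fun setT f -> (forall x, (0 <= f x)%E) ->
  (\int[P]_w f (L w) = if s == 0%R then f m else \int[normal_prob m s]_x f x)%E.
Proof.
move=> mf f0; case: ifPn => s0.
  rewrite -(ge0_integral_distribution L mf f0).
  rewrite (@eq_measure_integral _ _ _ _ (\d_m)); last first.
    by move=> A mA _; have := hL mA; rewrite /normal_law s0.
  by rewrite integral_dirac// diracT mul1e.
(* The library's [normal_prob] lives on [measurableTypeR R], which carries the
   same sets as [R] under another display. *)
have mL : measurable_fun setT (L : Omega -> measurableTypeR R) :=
  @measurable_funPT _ _ _ _ L.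
pose L' : {RV P >-> measurableTypeR R} :=
  @mfun_Sub _ _ Omega (measurableTypeR R) L (mem_set mL).
have mf' : measurable_fun [set: measurableTypeR R] f := mf.
rewrite (_ : (\int[P]_w _)%E = (\int[P]_w (f \o L') w)%E)//.
rewrite -(ge0_integral_distribution L' mf' f0).
apply: eq_measure_integral => A mA _.
by have := hL mA; rewrite /normal_law (negbTE s0).
Qed.

Lemma normal_rv_mgf t :
  (\int[P]_w (expR (t * L w))%:E = (expR (t * m + t ^+ 2 * s ^+ 2 / 2))%:E)%E.
Proof.
rewrite (@ge0_integral_normal_rv (fun x => (expR (t * x))%:E)); last 2 first.
- by apply/measurable_EFinP; apply: measurableT_comp.
- by move=> x; rewrite lee_fin expR_ge0.
case: eqVneq => [->|s0]; last exact: normal_prob_mgf.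
by congr (expR _)%:E; rewrite expr0n/= mulr0 mul0r addr0.
Qed.

(** Integrating [1 + t * L <= expR (t * L)] shows that the moment generating function is at least 1,
    so its exponent is nonnegative for every [t]; near [t = 0] the linear term [t * m] dominates and
    must vanish. *)
Lemma normal_rv_mean0 : P.-integrable setT (EFin \o L) ->
  (\int[P]_w (L w)%:E = 0)%E -> m = 0.
Proof.
move=> iL L0.
have key t : 0 <= t * m + t ^+ 2 * s ^+ 2 / 2.
  rewrite -ler_expR expR0 -lee_fin -normal_rv_mgf.
  have -> : (1%:E = \int[P]_w ((EFin \o cst 1%R) \+ (fun x => t%:E * (EFin \o L) x)) w)%E.
    rewrite integralD//; last 2 first.
    - exact: finite_measure_integrable_cst.
    - exact: integrableZl.
    rewrite integralZl// L0 mule0 adde0/=.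
    by rewrite integral_cst//= probability_setT mule1.
  apply: le_integral => //.
  - apply: integrableD => //; first exact: finite_measure_integrable_cst.
    exact: integrableZl.
  - apply/integrableP; split.
      apply/measurable_EFinP; apply: measurableT_comp => //.
      exact: measurable_funM.
    under eq_integral do rewrite /= ger0_norm ?expR_ge0//.
    by rewrite normal_rv_mgf ltry.
  - by move=> w _; rewrite /= -EFinM -EFinD lee_fin expR_ge1Dx.
apply/eqP/negP => /negP m0.
have D0 : 0 < s ^+ 2 + 1 by have := sqr_ge0 s; lra.
(* A [t] of sign opposite to [m], small enough for the linear term to win; the added 1 covers
   [s = 0]. *)
have := key (- m / (s ^+ 2 + 1)).
have -> : - m / (s ^+ 2 + 1) * m + (- m / (s ^+ 2 + 1)) ^+ 2 * s ^+ 2 / 2 =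
    - (m ^+ 2 / (s ^+ 2 + 1) ^+ 2 * (s ^+ 2 / 2 + 1)).
  by field; rewrite gt_eqF.
rewrite oppr_ge0 leNgt mulr_gt0//.
- by apply: divr_gt0; rewrite exprn_even_gt0//= gt_eqF.
- by have := sqr_ge0 s; lra.
Qed.

Lemma normal_rv_sqr : m = 0 -> (\int[P]_w (L w ^+ 2)%:E = (s ^+ 2)%:E)%E.
Proof.
move=> m0; rewrite (@ge0_integral_normal_rv (fun x => (x ^+ 2)%:E)); last 2 first.
- by apply/measurable_EFinP; exact: measurable_funX.
- by move=> x; rewrite lee_fin sqr_ge0.
by rewrite m0; case: eqVneq => [->|s0]//; exact: normal_prob_sqr.
Qed.

(** Joint normality supplies [m] and [s] only existentially; the first two moments of [L] identify
    them. *)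
Lemma centered_normal_rv_mgf v : P.-integrable setT (EFin \o L) ->
  (\int[P]_w (L w)%:E = 0)%E -> (\int[P]_w (L w ^+ 2)%:E = v%:E)%E ->
  (\int[P]_w (expR (L w))%:E = (expR (v / 2))%:E)%E.
Proof.
move=> iL /(normal_rv_mean0 iL) m0; rewrite normal_rv_sqr// => -[<-].
have := normal_rv_mgf 1; under eq_integral do rewrite mul1r.
by move=> ->; rewrite m0 mul1r expr1n mul1r add0r.
Qed.

End normal_random_variable.

(** * Linear combinations of equicorrelated normal variables *)

Definition lincomb {R : realType} {d : measure_display} {Omega : measurableType d}
    {P : probability Omega R} {n : nat} (X : 'I_n -> {RV P >-> R}) (c : 'I_n -> R)
    (w : Omega) : R :=
  \sum_(i < n) c i * X i w.

Section lincomb_measurable.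
Context {R : realType} {d : measure_display} {Omega : measurableType d}.
Context {P : probability Omega R} {n : nat} (X : 'I_n -> {RV P >-> R}) (c : 'I_n -> R).

Let measurable_lincomb : measurable_fun setT (lincomb X c).
Proof. by apply: measurable_sum => i; exact: measurable_funM. Qed.

HB.instance Definition _ :=
  isMeasurableFun.Build _ _ _ _ (lincomb X c) measurable_lincomb.

End lincomb_measurable.

(** The quadratic form of the covariance matrix with 1 on the diagonal and [rho] elsewhere, that is,
    the variance of [lincomb X c]. *)
Definition equicorrelated_form {R : realType} (rho : R) {n : nat} (c : 'I_n -> R) : R :=
  (1 - rho) * (\sum_(i < n) c i ^+ 2) + rho * (\sum_(i < n) c i) ^+ 2.

Section equicorrelated_lincomb.
Context {R : realType} {d : measure_display} {Omega : measurableType d}.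
Context {P : probability Omega R} {n : nat} (rho : R) (X : 'I_n -> {RV P >-> R}).
Hypothesis hX : equicorrelated_normal (fun=> 0) rho X.
Implicit Types (c : 'I_n -> R) (i j : 'I_n).

Let integralX i : (\int[P]_w (X i w)%:E = 0)%E.
Proof. by case: hX => _ /(_ i) + _ _; rewrite unlock. Qed.

Let covarianceXE i j : covariance P (X i) (X j) = (\int[P]_w (X i w * X j w)%:E)%E.
Proof.
case: hX => _ E0 _ _; rewrite [in LHS]unlock !E0/= [in LHS]unlock.
by apply: eq_integral => w _ /=; rewrite !fctE /= !subr0.
Qed.

Let integralX2 i : (\int[P]_w (X i w * X i w)%:E = 1)%E.
Proof. by rewrite -covarianceXE; case: hX => _ _ /(_ i). Qed.

Let measurableXX i j : measurable_fun setT (fun w => (X i w * X j w)%:E).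
Proof. by apply/measurable_EFinP; exact: measurable_funM. Qed.

Let integrableX2 i : P.-integrable setT (fun w => (X i w * X i w)%:E).
Proof.
apply/integrableP; split => //.
under eq_integral do rewrite gee0_abs ?lee_fin -?expr2 ?sqr_ge0// expr2.
by rewrite integralX2 ltry.
Qed.

Let integrableXX i j : P.-integrable setT (fun w => (X i w * X j w)%:E).
Proof.
apply: (le_integrable _ _ _ (integrableD _ (integrableX2 i) (integrableX2 j))) => //.
move=> w _ /=; rewrite lee_fin [leRHS]ger0_norm -?expr2 ?addr_ge0 ?sqr_ge0//.
by rewrite ler_norml; apply/andP; split; nra.
Qed.

Let integrableX i : P.-integrable setT (EFin \o X i).
Proof.
have i1 : P.-integrable setT (EFin \o cst (1 : R)).
  exact: finite_measure_integrable_cst.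
have := integrableD measurableT i1 (integrableX2 i).
apply: le_integrable => //.
  exact/measurable_EFinP.
move=> w _ /=; rewrite lee_fin [leRHS]ger0_norm -?expr2 ?addr_ge0 ?sqr_ge0//.
by rewrite ler_norml; apply/andP; split; nra.
Qed.

Let integralXX i j :
  (\int[P]_w (X i w * X j w)%:E = (rho + (1 - rho) * (i == j)%:R)%:E)%E.
Proof.
case: eqVneq => [->|ij]; first by rewrite integralX2 mulr1 subrKC.
(* [correlation] sees the covariance only through [fine], so its finiteness is needed to recover the
   integral. *)
have fin : (\int[P]_w (X i w * X j w)%:E)%E \is a fin_num.
  exact: integrable_fin_num.
rewrite mulr0 addr0 -[LHS]fineK//; congr EFin.
case: hX => _ _ V1 /(_ i j ij) <-.
by rewrite /correlation !V1 covarianceXE/= sqrtr1 mulr1 divr1.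
Qed.

Lemma integrable_lincomb c : P.-integrable setT (EFin \o lincomb X c).
Proof.
rewrite (_ : _ \o _ = (fun w => \sum_(i < n) ((c i)%:E * (EFin \o X i) w)%E)%E).
  by apply: integrable_sum => // i _; exact: integrableZl.
by apply/funext => w /=; rewrite /lincomb -sumEFin.
Qed.

Lemma integral_lincomb c : (\int[P]_w (lincomb X c w)%:E = 0)%E.
Proof.
have -> : (\int[P]_w (lincomb X c w)%:E =
    \int[P]_w (\sum_(i < n) (c i)%:E * (X i w)%:E))%E.
  by apply: eq_integral => w _; rewrite /lincomb -sumEFin.
rewrite integral_sum//; last first.
  by move=> i; apply: integrableZl => //; exact: integrableX.
by rewrite big1// => i _; rewrite integralZl ?integralX ?mule0//; exact: integrableX.
Qed.

Lemma integral_lincomb_sqr c :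
  (\int[P]_w (lincomb X c w ^+ 2)%:E = (equicorrelated_form rho c)%:E)%E.
Proof.
have -> : (\int[P]_w (lincomb X c w ^+ 2)%:E = \int[P]_w (\sum_(i < n)
    \sum_(j < n) (c i * c j)%:E * (X i w * X j w)%:E))%E.
  apply: eq_integral => w _; rewrite expr2 /lincomb mulr_suml -sumEFin.
  apply: eq_bigr => i _; rewrite mulr_sumr -sumEFin.
  by apply: eq_bigr => j _; rewrite -EFinM mulrACA.
rewrite integral_sum//; last first.
  by move=> i; apply: integrable_sum => // j _; apply: integrableZl.
under eq_bigr => i _.
  rewrite integral_sum//; last by move=> j; apply: integrableZl.
  under eq_bigr => j _ do rewrite integralZl// integralXX -EFinM.
  rewrite sumEFin.
  over.
rewrite sumEFin; congr EFin; rewrite /equicorrelated_form [RHS]addrC.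
rewrite expr2 mulr_suml !mulr_sumr -big_split/=; apply: eq_bigr => i _.
under eq_bigr => j _ do rewrite mulrDr.
rewrite big_split/=; congr (_ + _).
  by rewrite mulrA mulr_sumr; apply: eq_bigr => j _; ring.
rewrite (bigD1 i)//= big1 => [|j ji].
  by rewrite eqxx mulr1 addr0 mulrC -expr2.
by rewrite eq_sym (negbTE ji) !mulr0.
Qed.

(** The one place where joint normality itself is opened; every later estimate goes through this
    formula. *)
Lemma lincomb_mgf c :
  (\int[P]_w (expR (lincomb X c w))%:E =
   (expR (equicorrelated_form rho c / 2))%:E)%E.
Proof.
have [jn _ _ _] := hX; have [m [s hL]] := jn c.
apply: (centered_normal_rv_mgf (m := m) (s := s)).
- exact: hL.
- exact: integrable_lincomb.
- exact: integral_lincomb.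
- exact: integral_lincomb_sqr.
Qed.

End equicorrelated_lincomb.

(** * Markov and Chebyshev inequalities *)

Section tail_bounds.
Context {R : realType} {d : measure_display} {Omega : measurableType d}.
Context (P : probability Omega R).
Implicit Types (f : Omega -> R) (a b m : R).

Lemma ge0_markov f a b : measurable_fun setT f -> (forall w, 0 <= f w) -> 0 < a ->
  (\int[P]_w (f w)%:E <= b%:E)%E -> (P [set w | (a <= f w)%R] <= (b / a)%:E)%E.
Proof.
move=> mf f0 a0 fb; set A := [set w | a <= f w].
have mA : measurable A.
  by rewrite -[A]setTI; exact: measurable_fun_le.
rewrite EFinM lee_pdivlMr//; apply: le_trans fb.
rewrite muleC -integral_cst// integral_mkcond.
apply: ge0_le_integral => //=.
- by move=> w _; rewrite patchE; case: ifPn => // _; rewrite lee_fin ltW.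
- by apply/(measurable_restrictT _ mA); exact: measurable_cst.
- exact/measurable_EFinP.
- by move=> w _; rewrite patchE; case: ifPn => [/[!inE]//|_]; rewrite lee_fin.
Qed.

(** Chebyshev: the variance is at most [b], and [f w <= m / 2] forces
    [(f w - m) ^+ 2 >= m ^+ 2 / 4]. *)
Lemma ge0_lower_tail f m b : measurable_fun setT f -> (forall w, 0 <= f w) -> 0 < m ->
  (\int[P]_w (f w)%:E = m%:E)%E ->
  (\int[P]_w (f w ^+ 2)%:E <= (m ^+ 2 + b)%:E)%E ->
  (P [set w | (f w <= m / 2)%R] <= (4 * b / m ^+ 2)%:E)%E.
Proof.
move=> mf f0 m0 fm f2.
have mfm : measurable_fun setT (fun w => (f w - m) ^+ 2).
  by apply: measurable_funX; exact: measurable_funB.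
have mf2 : measurable_fun setT (fun w => f w ^+ 2) by exact: measurable_funX.
have fsq : (\int[P]_w ((f w - m) ^+ 2)%:E <= b%:E)%E.
  (* Adding [2 * m * f] turns the square into [f ^+ 2 + m ^+ 2], so only nonnegative functions are
     integrated. *)
  have : (\int[P]_w ((f w - m) ^+ 2)%:E + (2 * m)%:E * \int[P]_w (f w)%:E <=
          b%:E + (2 * m)%:E * m%:E)%E.
    rewrite -ge0_integralZl//; last 3 first.
    - exact/measurable_EFinP.
    - by move=> w _; rewrite lee_fin.
    - by rewrite lee_fin; lra.
    rewrite -ge0_integralD//; last 4 first.
    - by move=> w _; rewrite lee_fin sqr_ge0.
    - exact/measurable_EFinP.
    - by move=> w _; rewrite -EFinM lee_fin mulr_ge0//; lra.
    - by apply/measurable_EFinP; exact: measurable_funM.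
    have -> : (\int[P]_w (((f w - m) ^+ 2)%:E + (2 * m)%:E * (f w)%:E) =
               \int[P]_w ((f w ^+ 2)%:E + (cst (m ^+ 2)%:E w)))%E.
      by apply: eq_integral => w _; rewrite -EFinM -!EFinD; congr EFin; ring.
    rewrite ge0_integralD//; last 3 first.
    - by move=> w _; rewrite lee_fin sqr_ge0.
    - exact/measurable_EFinP.
    - by move=> w _; rewrite lee_fin sqr_ge0.
    rewrite integral_cst//= probability_setT mule1.
    rewrite (_ : b%:E + _ = (m ^+ 2 + b)%:E + (m ^+ 2)%:E)%E; last first.
      by rewrite -EFinM -!EFinD; congr EFin; ring.
    exact: leeD.
  by rewrite fm leeD2rE.
have -> : 4 * b / m ^+ 2 = b / (m ^+ 2 / 4) by field; rewrite gt_eqF.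
apply: le_trans (ge0_markov mfm _ _ fsq); last 2 first.
- by move=> w; exact: sqr_ge0.
- by rewrite divr_gt0 ?exprn_gt0.
apply: le_measure; rewrite ?inE.
- by rewrite -[X in measurable X]setTI; exact: measurable_fun_le.
- by rewrite -[X in measurable X]setTI; exact: measurable_fun_le.
- by move=> w /=; nra.
Qed.

End tail_bounds.

(** * The mean of the variables and the deviations from it *)

Section deviations.
Context {R : realType} {d : measure_display} {Omega : measurableType d}.
Context {P : probability Omega R} {n : nat} (rho : R) (X : 'I_n -> {RV P >-> R}).
Hypotheses (rho_gt0 : 0 < rho) (rho_lt1 : rho < 1).
Hypothesis hX : equicorrelated_normal (fun=> 0) rho X.
Hypothesis n_gt0 : (0 < n)%N.
Implicit Types (c : 'I_n -> R) (i j k : 'I_n) (w : Omega) (t u K B : R).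

Lemma lincombZ t c w : t * lincomb X c w = lincomb X (fun k => t * c k) w.
Proof. by rewrite /lincomb mulr_sumr; apply: eq_bigr => k _; rewrite mulrA. Qed.

Lemma lincombD c c' w :
  lincomb X c w + lincomb X c' w = lincomb X (fun k => c k + c' k) w.
Proof. by rewrite /lincomb -big_split/=; apply: eq_bigr => k _; rewrite mulrDl. Qed.

Lemma lincomb_mgf_bound v c : equicorrelated_form rho c <= v ->
  (\int[P]_w (expR (lincomb X c w))%:E <= (expR (v / 2))%:E)%E.
Proof.
by move=> cv; rewrite (lincomb_mgf hX) lee_fin ler_expR ler_pM2r ?invr_gt0.
Qed.

Let measurable_expR_lincomb c : measurable_fun setT (fun w => expR (lincomb X c w)).
Proof. exact: measurableT_comp. Qed.

(** Chernoff: Markov's inequality for [expR (t * lincomb X c w)], with [v] bounding the variance of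
    the exponent. *)
Lemma lincomb_tail v c t u : equicorrelated_form rho (fun k => t * c k) <= v ->
  0 < t -> (P [set w | (u <= lincomb X c w)%R] <= (expR (v / 2 - t * u))%:E)%E.
Proof.
move=> cv t0.
have -> : [set w | u <= lincomb X c w] =
    [set w | expR (t * u) <= expR (lincomb X (fun k => t * c k) w)].
  by apply/seteqP; split => w /=; rewrite ler_expR -lincombZ ler_pM2l.
have -> : expR (v / 2 - t * u) = expR (v / 2) / expR (t * u).
  by rewrite expRD expRN.
apply: ge0_markov; [exact: measurable_expR_lincomb| |exact: expR_gt0|].
  by move=> w; exact: expR_ge0.
exact: lincomb_mgf_bound.
Qed.

(** The coefficient vectors of M and, for [dev_coef i], of Y_i. *)
Definition mean_coef k : R := n%:R^-1.
Definition dev_coef i k : R := (k == i)%:R - n%:R^-1.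

Let N_gt0 : 0 < n%:R :> R. Proof. by rewrite ltr0n. Qed.
Let N_neq0 : n%:R != 0 :> R. Proof. by rewrite gt_eqF. Qed.
Let N_ge1 : 1 <= n%:R :> R. Proof. by rewrite ler1n. Qed.

Let residual_var_le1 : (1 - rho) * (1 - n%:R^-1) <= 1.
Proof.
have i0 : 0 <= n%:R^-1 :> R by rewrite invr_ge0 ltW.
have i1 : n%:R^-1 <= 1 :> R by rewrite invf_le1.
by rewrite mulr_ile1// ?subr_ge0// ?gerBl// ltW.
Qed.

Let sum_delta i (F : 'I_n -> R) : \sum_k (k == i)%:R * F k = F i.
Proof.
rewrite (bigD1 i)//= eqxx mul1r big1 ?addr0// => k ki.
by rewrite (negbTE ki) mul0r.
Qed.

Let sum_dev i : \sum_k dev_coef i k = 0.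
Proof.
rewrite /dev_coef big_split/= -[X in X + _](eq_bigr _ (fun k _ => mulr1 _)) sum_delta.
by rewrite sumr_const card_ord mulNrn -(mulr_natr n%:R^-1) mulVf// subrr.
Qed.

(** [dev_coef i] is the orthogonal projection of the i-th basis vector off the constant vectors, so
    the inner products are the entries of the projection matrix. *)
Let sum_dev_mul i j :
  \sum_k dev_coef i k * dev_coef j k = (i == j)%:R - n%:R^-1.
Proof.
under eq_bigr => k _ do rewrite {1}/dev_coef mulrBl.
rewrite big_split/= sum_delta sumrN -mulr_sumr sum_dev mulr0 subr0.
by rewrite /dev_coef.
Qed.

Lemma dev_lincombE i w : lincomb X (dev_coef i) w = X i w - lincomb X mean_coef w.
Proof.
apply/eqP; rewrite eq_sym subr_eq lincombD /lincomb; apply/eqP.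
under eq_bigr => k _ do rewrite /dev_coef /mean_coef subrK.
by rewrite sum_delta.
Qed.

Lemma form_mean t : equicorrelated_form rho (fun k => t * mean_coef k) <= t ^+ 2.
Proof.
rewrite /equicorrelated_form /mean_coef !sumr_const card_ord.
rewrite -(mulr_natr ((t / n%:R) ^+ 2)) -(mulr_natr (t / n%:R)) divfK//.
have -> : (t / n%:R) ^+ 2 * n%:R = t ^+ 2 / n%:R by field.
have : 0 <= (1 - rho) * (t ^+ 2 - t ^+ 2 / n%:R).
  apply: mulr_ge0; first by rewrite subr_ge0 ltW.
  by rewrite subr_ge0 ler_piMr ?sqr_ge0// invf_le1.
by lra.
Qed.

(** The coefficients sum to 0, which removes the [rho] term: the component shared by all variables
    cancels. *)
Lemma form_dev t i : equicorrelated_form rho (fun k => t * dev_coef i k) =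
  t ^+ 2 * ((1 - rho) * (1 - n%:R^-1)).
Proof.
rewrite /equicorrelated_form -mulr_sumr sum_dev mulr0 expr0n/= mulr0 addr0.
under eq_bigr => k _ do rewrite exprMn [X in _ * X]expr2.
by rewrite -mulr_sumr sum_dev_mul eqxx mulrCA.
Qed.

(** The cross term is the covariance of two deviations, a nonpositive multiple of [n%:R^-1], and is
    dropped. *)
Lemma form_devD t i j : i != j ->
  equicorrelated_form rho (fun k => t * dev_coef i k + t * dev_coef j k) <=
  2 * (t ^+ 2 * ((1 - rho) * (1 - n%:R^-1))).
Proof.
move=> ij.
rewrite /equicorrelated_form big_split/= -!mulr_sumr !sum_dev mulr0 addr0.
rewrite expr0n/= mulr0 addr0.
have -> : \sum_k (t * dev_coef i k + t * dev_coef j k) ^+ 2 =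
    t ^+ 2 * (2 * (1 - n%:R^-1) - 2 * n%:R^-1).
  transitivity (t ^+ 2 * (\sum_k (dev_coef i k * dev_coef i k +
      dev_coef j k * dev_coef j k + 2 * (dev_coef i k * dev_coef j k)))).
    by rewrite mulr_sumr; apply: eq_bigr => k _; ring.
  by rewrite !big_split/= -mulr_sumr !sum_dev_mul !eqxx (negbTE ij)/=; ring.
have i0 : 0 <= n%:R^-1 :> R by rewrite invr_ge0 ltW.
have r0 : 0 <= (1 - rho) * t ^+ 2 by rewrite mulr_ge0 ?sqr_ge0// subr_ge0 ltW.
have := mulr_ge0 r0 i0; lra.
Qed.

Lemma mean_tail K :
  (P [set w | (K <= lincomb X mean_coef w)%R] <= (expR (2^-1 - K))%:E)%E.
Proof.
have v1 : equicorrelated_form rho (fun k => 1 * mean_coef k) <= 1.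
  by apply: le_trans (form_mean 1) _; rewrite expr1n.
by have := lincomb_tail K v1 ltr01; rewrite !mul1r.
Qed.

(** Chernoff with [t = u / (1 - rho)], the optimal choice for variance [1 - rho]. *)
Lemma dev_tail i u : 0 < u ->
  (P [set w | (u <= lincomb X (dev_coef i) w)%R] <=
   (expR (- (u ^+ 2 / (2 * (1 - rho)))))%:E)%E.
Proof.
move=> u0; have r0 : 0 < 1 - rho by rewrite subr_gt0.
have := @lincomb_tail (u ^+ 2 / (1 - rho)) (dev_coef i) (u / (1 - rho)) u.
have -> : u ^+ 2 / (1 - rho) / 2 - u / (1 - rho) * u =
    - (u ^+ 2 / (2 * (1 - rho))) by field; rewrite gt_eqF.
apply; last by rewrite divr_gt0.
rewrite form_dev (_ : _ * _ = u ^+ 2 / (1 - rho) * (1 - n%:R^-1)); last first.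
  by field; rewrite N_neq0 gt_eqF.
rewrite ler_piMr//.
by rewrite divr_ge0 ?sqr_ge0 ?ltW.
Qed.

Definition exp_mean t w : R :=
  n%:R^-1 * \sum_i expR (lincomb X (fun k => t * dev_coef i k) w).

Let mgf_dev t : R := expR (t ^+ 2 * ((1 - rho) * (1 - n%:R^-1)) / 2).

Lemma measurable_exp_mean t : measurable_fun setT (exp_mean t).
Proof.
apply: measurable_funM => //; apply: measurable_sum => i.
exact: measurable_expR_lincomb.
Qed.

Lemma exp_mean_ge0 t w : 0 <= exp_mean t w.
Proof.
apply: mulr_ge0; first by rewrite invr_ge0 ltW.
by apply: sumr_ge0 => i _; exact: expR_ge0.
Qed.

Lemma integral_exp_mean t : (\int[P]_w (exp_mean t w)%:E = (mgf_dev t)%:E)%E.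
Proof.
rewrite /exp_mean; under eq_integral do rewrite EFinM -sumEFin.
rewrite ge0_integralZl//; last 2 first.
- apply: emeasurable_sum => i; apply/measurable_EFinP.
  exact: measurable_expR_lincomb.
- by move=> w _; rewrite sume_ge0// => i _; rewrite lee_fin expR_ge0.
rewrite ge0_integral_sum//; last first.
  by move=> i; apply/measurable_EFinP; exact: measurable_expR_lincomb.
under eq_bigr => i _ do rewrite (lincomb_mgf hX) form_dev.
rewrite sumEFin sumr_const card_ord -EFinM; congr EFin.
by rewrite mulrnAr -[LHS]mulr_natr mulrAC mulVf ?mul1r.
Qed.

(** The square expands over pairs of indices: each diagonal pair contributes [mgf_dev (2 * t)], and
    every other one at most [mgf_dev t ^+ 2] because the covariance is nonpositive. *)
Lemma integral_exp_mean_sqr t : (\int[P]_w (exp_mean t w ^+ 2)%:E <=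
  (mgf_dev t ^+ 2 + n%:R^-1 * mgf_dev (2 * t))%:E)%E.
Proof.
pose G i j w : \bar R :=
  (expR (lincomb X (fun k => t * dev_coef i k + t * dev_coef j k) w))%:E.
have -> : (\int[P]_w (exp_mean t w ^+ 2)%:E =
    \int[P]_w ((n%:R ^- 2)%:E * \sum_i \sum_j G i j w))%E.
  apply: eq_integral => w _; rewrite /exp_mean exprMn exprVn EFinM; congr (_ * _)%E.
  rewrite expr2 mulr_suml -sumEFin; apply: eq_bigr => i _.
  rewrite mulr_sumr -sumEFin; apply: eq_bigr => j _.
  by rewrite -expRD lincombD.
have mG i j : measurable_fun setT (G i j).
  by apply/measurable_EFinP; exact: measurable_expR_lincomb.
have G0 i j w : (0 <= G i j w)%E by rewrite lee_fin expR_ge0.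
have mS i : measurable_fun setT (fun w => \sum_j G i j w)%E by exact: emeasurable_sum.
have S0 i w : (0 <= \sum_j G i j w)%E by apply: sume_ge0.
rewrite ge0_integralZl//; last 2 first.
- exact: emeasurable_sum.
- by move=> w _; apply: sume_ge0.
rewrite ge0_integral_sum//.
under eq_bigr => i _.
  rewrite ge0_integral_sum//.
  under eq_bigr => j _ do rewrite (lincomb_mgf hX).
  rewrite sumEFin.
  over.
rewrite sumEFin -EFinM lee_fin.
have row i : \sum_j expR (equicorrelated_form rho
    (fun k => t * dev_coef i k + t * dev_coef j k) / 2) <=
    mgf_dev (2 * t) + n%:R * mgf_dev t ^+ 2.
  rewrite (bigD1 i)//=; apply: lerD.
    rewrite (_ : (fun k => _) = (fun k => 2 * t * dev_coef i k)); last first.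
      by apply/funext => k; ring.
    by rewrite form_dev.
  (* The off-diagonal terms of the row are bounded one by one, then padded to [n] terms. *)
  apply: (@le_trans _ _ (\sum_(j < n | j != i) mgf_dev t ^+ 2)).
    apply: ler_sum => j ji; rewrite /mgf_dev -expRM_natl ler_expR.
    have := @form_devD t i j; rewrite eq_sym => /(_ ji); lra.
  rewrite mulr_natl -[X in _ <= _ *+ X]card_ord -sumr_const.
  rewrite [leRHS](bigD1 i)//= lerDr; exact: sqr_ge0.
apply: (@le_trans _ _ (n%:R ^- 2 *
    \sum_(i < n) (mgf_dev (2 * t) + n%:R * mgf_dev t ^+ 2))).
  by apply: ler_wpM2l; [rewrite invr_ge0 exprn_ge0// ltW|exact: ler_sum].
rewrite sumr_const card_ord -mulr_natr.
by rewrite le_eqVlt; apply/orP; left; apply/eqP; field.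
Qed.

(** Chebyshev with variance bound [mgf_dev (2 * t) / n%:R]; the quotient of [mgf_dev (2 * t)] by
    [mgf_dev t ^+ 2] is at most [expR (t ^+ 2)]. *)
Lemma exp_mean_lower_tail t :
  (P [set w | (exp_mean t w <= expR (t ^+ 2 * ((1 - rho) * (1 - n%:R^-1)) / 2) / 2)%R] <=
   (4 * expR (t ^+ 2) / n%:R)%:E)%E.
Proof.
have := @ge0_lower_tail _ _ _ P (exp_mean t) (mgf_dev t)
  (n%:R^-1 * mgf_dev (2 * t)) (measurable_exp_mean t) (exp_mean_ge0 t)
  (expR_gt0 _) (integral_exp_mean t) (integral_exp_mean_sqr t).
move=> /le_trans; apply; rewrite lee_fin mulrA [X in X / _]mulrAC -mulrA mulrA.
rewrite -!mulrA ler_pM2l// mulrCA [leRHS]mulrC ler_pM2l ?invr_gt0//.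
rewrite /mgf_dev -expRM_natl -expRN -expRD ler_expR.
set q := (1 - rho) * _.
rewrite (_ : _ - _ = t ^+ 2 * q); last by field.
by rewrite ler_piMr ?sqr_ge0// residual_var_le1.
Qed.

Lemma exp_mean_upper_tail t B : 0 < B ->
  (P [set w | (B <= exp_mean t w)%R] <= (expR (t ^+ 2 / 2) / B)%:E)%E.
Proof.
move=> B0; apply: ge0_markov => //.
- exact: measurable_exp_mean.
- exact: exp_mean_ge0.
- rewrite integral_exp_mean lee_fin /mgf_dev ler_expR ler_pM2r ?invr_gt0//.
  by rewrite ler_piMr ?sqr_ge0// residual_var_le1.
Qed.

End deviations.

(** * P-values and Hommel's procedure *)

Section pvalues.
Context {R : realType}.
Implicit Types x y z T a : R.

Let N01 : probability (measurableTypeR R) R := normal_prob 0 1.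

Let PhiE x : (Phi x)%:E = N01 `]-oo, x]%classic.
Proof. by rewrite /Phi fineK// fin_num_measure. Qed.

Lemma Phi_nondecreasing : nondecreasing_fun (Phi : R -> R).
Proof.
move=> x y xy; rewrite -lee_fin !PhiE; apply: le_measure; rewrite ?inE//=.
exact: subset_itvl.
Qed.

Lemma pvalue_nonincreasing : nonincreasing_fun (pvalue : R -> R).
Proof. by move=> x y xy; rewrite /pvalue lerB// Phi_nondecreasing. Qed.

Lemma measurable_pvalue : measurable_fun setT (pvalue : R -> R).
Proof. by apply: nonincreasing_measurable => //; exact: pvalue_nonincreasing. Qed.

(** Markov for [expR (- x)] gives [Phi x <= expR (2^-1 + x)]; at the witness this is
    [(1 - a) * expR (- 2^-1)], below [1 - a]. *)
Lemma exists_pvalue_gt a : a < 1 -> exists z, a < pvalue z.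
Proof.
move=> a1; exists (ln (1 - a) - 1).
have : (N01 [set x : R | (expR (- (ln (1 - a) - 1)) <= expR (-1 * x))%R] <=
    (expR (2^-1) / expR (- (ln (1 - a) - 1)))%:E)%E.
  apply: ge0_markov => //.
  - by apply: measurableT_comp.
  - exact: expR_gt0.
  - by rewrite normal_prob_mgf// mulr0 add0r sqrrN !expr1n !mul1r.
rewrite (_ : [set x | _] = `]-oo, ln (1 - a) - 1]%classic); last first.
  by apply/seteqP; split=> x /=; rewrite in_itv/= ler_expR mulN1r lerN2.
rewrite -PhiE lee_fin -expRN -expRD opprK => /le_lt_trans h.
rewrite /pvalue ltrBrDl -ltrBrDr; apply: h.
rewrite -[ltRHS]lnK ?posrE ?subr_gt0// ltr_expR; lra.
Qed.

(** The p-value at [T] is at least the normal mass of the unit interval from [T] to [T + 1], on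
    which the density is smallest at the right end. *)
Lemma pvalue_ge_pdf T x : 0 <= T -> x <= T -> normal_pdf 0 1 (T + 1) <= pvalue x.
Proof.
move=> T0 xT; apply: le_trans (pvalue_nonincreasing xT).
have -> : pvalue T = fine (N01 (~` `]-oo, T]%classic)).
  by rewrite probability_setC//= -PhiE.
rewrite -lee_fin fineK ?fin_num_measure//; last exact: measurableC.
apply: (@le_trans _ _ (N01 `]T, (T + 1)]%classic)); last first.
  apply: le_measure; rewrite ?inE//=; first exact: measurableC.
  by move=> y /=; rewrite !in_itv/= => /andP[Ty _]; rewrite leNgt Ty.
rewrite /N01/= /normal_prob.
apply: (@le_trans _ _ (\int[lebesgue_measure]_(y in `]T, (T + 1)%R])
  (normal_pdf 0 1 (T + 1)%R)%:E)%E).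
  rewrite integral_cst//= lebesgue_measure_itv/= lte_fin ltrDl ltr01.
  by rewrite -EFinD addrAC subrr add0r mule1.
apply: ge0_le_integral => //=.
- by move=> y _; rewrite lee_fin normal_pdf_ge0.
- by apply/measurable_EFinP/measurable_funTS; exact: measurable_normal_pdf.
- move=> y; rewrite in_itv/= => /andP[Ty yT].
  rewrite lee_fin !normal_pdfE ?oner_eq0// ler_pM2l ?normal_peak_gt0 ?oner_eq0//.
  rewrite /normal_fun ler_expR !subr0 !mulNr lerN2 ler_pM2r; last first.
    by rewrite invr_gt0 expr1n.
  by rewrite ler_pXn2r// nnegrE; lra.
Qed.

End pvalues.

Section hommel_procedure.
Context {R : realType} {n : nat}.
Implicit Types (p q : 'I_n -> R) (i : 'I_n) (k : nat) (t alpha : R).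

(** Trades order statistics for counting; the range of [k] keeps the index [k.-1] inside the sorted
    list, away from the default of [nth]. *)
Lemma lt_ordered_pvalue p k t : (0 < k <= n)%N ->
  (t < ordered_pvalue p k) = (#|[set i | (p i <= t)%R]%SET| < k)%N.
Proof.
case: k => [//|k] /= kn; set s := [seq p i | i <- enum 'I_n].
have ss : sorted <=%R (sort <=%R s) by exact: sort_le_sorted.
have sizes : size (sort <=%R s) = n by rewrite size_sort size_map size_enum_ord.
have -> : #|[set i | (p i <= t)%R]%SET| = count (<= t) (sort <=%R s).
  rewrite count_sort count_map enumT cardE /enum_mem size_filter.
  by apply: eq_count => i /=; rewrite inE.
rewrite ltnS; case: leqP => ck.
- by apply: nth_count_gt => //; rewrite ck sizes.
- by apply/negbTE; rewrite -leNgt; exact: nth_count_le.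
Qed.

(** With N this cardinal, only n - N p-values are at most [alpha], so the (n - N + k)-th smallest
    exceeds [alpha], which is at least [k * alpha / N] for k <= N. *)
Lemma card_hommel_index p alpha : 0 < alpha ->
  (0 < #|[set i | (alpha < p i)%R]%SET|)%N ->
  #|[set i | (alpha < p i)%R]%SET| \in hommel_indices alpha p.
Proof.
set N := #|_| => alpha0 N0; have Nn : (N <= n)%N.
  by rewrite -[leqRHS]card_ord max_card.
rewrite mem_filter mem_iota add1n ltnS N0 Nn !andbT.
apply/allP => k; rewrite mem_iota add1n ltnS => /andP[k1 kN].
have kle : k%:R * alpha / N%:R <= alpha.
  rewrite mulrAC; apply: ler_piMl; first exact: ltW.
  by rewrite ler_pdivrMr ?ltr0n// mul1r ler_nat.
apply: (le_lt_trans kle); rewrite lt_ordered_pvalue; last by lia.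
have -> : [set i | (p i <= alpha)%R]%SET = (~: [set i | (alpha < p i)%R])%SET.
  by apply/setP => i; rewrite !inE leNgt.
by rewrite cardsCs finset.setCK card_ord -/N; lia.
Qed.

Lemma hommel_rejection p alpha (N := #|[set i | (alpha < p i)%R]%SET|) i :
  0 < alpha -> (0 < N)%N -> i \in hommel alpha p -> p i <= alpha / N%:R.
Proof.
move=> alpha0 N0; have := card_hommel_index alpha0 N0; rewrite -/N /hommel.
case E : (hommel_indices alpha p) => [//|j s]; rewrite -E => NJ.
rewrite inE => /le_trans; apply.
have NM : (N <= \max_(j <- hommel_indices alpha p) j)%N.
  exact: (@leq_bigmax_seq _ _ xpredT id).
by rewrite ler_pM2l// lef_pV2 ?posrE ?ltr0n// ?ler_nat// (leq_trans N0).
Qed.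

(** The procedure depends on the p-values only through finitely many comparisons; this serves to
    prove its error event measurable. *)
Lemma eq_hommel p q alpha : 0 < alpha ->
  (forall i k j, (k <= n)%N -> (j <= n)%N ->
     (p i <= k%:R * alpha / j%:R) = (q i <= k%:R * alpha / j%:R)) ->
  hommel alpha p = hommel alpha q.
Proof.
move=> alpha0 pq.
have J : hommel_indices alpha p = hommel_indices alpha q.
  apply: eq_in_filter => i; rewrite mem_iota add1n ltnS => /andP[i1 iN].
  apply: eq_in_all => k; rewrite mem_iota add1n ltnS => /andP[k1 ki].
  rewrite !lt_ordered_pvalue; [|lia|lia]; congr (_ < _)%N; apply: eq_card => l.
  by rewrite !inE pq// (leq_trans ki).
rewrite /hommel -J; case E : (hommel_indices alpha p) => [//|j s]; rewrite -E.
apply/setP => i; rewrite !inE -[alpha]mul1r.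
apply: (pq i 1%N); first by case: i => i /=; apply: leq_ltn_trans.
apply/bigmax_leqP_seq => k + _.
by rewrite mem_filter mem_iota add1n ltnS => /andP[_ /andP[_]].
Qed.

End hommel_procedure.

(** [E] is a finite union, over the Boolean patterns realised in it, of finite intersections of
    measurable sets. *)
Lemma measurable_finite_factor {d : measure_display} {Omega : measurableType d}
    {I : finType} (b : I -> Omega -> bool) (E : set Omega) :
  (forall i, measurable [set w | b i w]) ->
  (forall w w', (forall i, b i w = b i w') -> E w -> E w') ->
  measurable E.
Proof.
move=> mb bE.
pose D := [set f : {ffun I -> bool} | exists2 w, E w & forall i, f i = b i w].
pose F (f : {ffun I -> bool}) := \bigcap_(i in [set: I]) [set w | b i w = f i].
have -> : E = \bigcup_(f in D) F f.
  apply/seteqP; split=> [w Ew|w [f [w' Ew' fb] Fw]].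
    exists [ffun i => b i w]; first by exists w => // i; rewrite ffunE.
    by move=> i _ /=; rewrite ffunE.
  by apply: bE Ew' => i; rewrite -fb -(Fw i).
apply: fin_bigcup_measurable; first exact: finite_finset.
move=> f _; apply: fin_bigcap_measurable; first exact: finite_finset.
move=> i _; case: (f i); first exact: mb.
rewrite (_ : [set w | _] = ~` [set w | b i w]); first exact: measurableC.
by apply/seteqP; split=> w /=; [move=> ->|move=> /negP/negbTE].
Qed.

Lemma measurable_hommel_errors {R : realType} {d : measure_display}
    {Omega : measurableType d} {P : probability Omega R} {n : nat} (mu : 'I_n -> R)
    (X : 'I_n -> {RV P >-> R}) (alpha : R) : 0 < alpha ->
  measurable
    [set w | (1 <= type1_errors mu (@hommel R n alpha (fun i => pvalue (X i w))))%N].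
Proof.
move=> alpha0.
pose b (ikj : 'I_n * ('I_n.+1 * 'I_n.+1)) w :=
  pvalue (X ikj.1 w) <= (ikj.2.1 : nat)%:R * alpha / (ikj.2.2 : nat)%:R.
apply: (@measurable_finite_factor _ _ _ b) => [ikj|w w' bw /=].
  rewrite -[X in measurable X]setTI; apply: measurable_fun_le => //.
  by apply: (measurableT_comp measurable_pvalue).
rewrite (@eq_hommel _ _ (fun i => pvalue (X i w)) (fun i => pvalue (X i w')))//.
move=> i k j kn jn.
exact: (bw (i, (Ordinal (kn : (k < n.+1)%N), Ordinal (jn : (j < n.+1)%N)))).
Qed.

(** * Bound on the familywise error rate *)

Lemma measurable_le_cst {R : realType} {d : measure_display} {Omega : measurableType d}
  (f : Omega -> R) (a : R) : measurable_fun setT f -> measurable [set w | f w <= a].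
Proof.
by move=> mf; rewrite -[X in measurable X]setTI; exact: measurable_fun_le.
Qed.

Lemma measurable_ge_cst {R : realType} {d : measure_display} {Omega : measurableType d}
  (f : Omega -> R) (a : R) : measurable_fun setT f -> measurable [set w | a <= f w].
Proof.
by move=> mf; rewrite -[X in measurable X]setTI; exact: measurable_fun_le.
Qed.

Lemma measure_has_le {R : realType} {d : measure_display} {Omega : measurableType d}
    (P : {measure set Omega -> \bar R}) (I : Type) (s : seq I) (b : I -> Omega -> bool) :
  (forall i, measurable [set w | b i w]) ->
  measurable [set w | has (b^~ w) s] /\
  (P [set w | has (b^~ w) s] <= \sum_(i <- s) P [set w | b i w])%E.
Proof.
move=> mb; elim: s => [|i s [mH PH]].
  by rewrite big_nil (_ : [set w | _] = set0) ?measure0//; apply/seteqP; split.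
rewrite big_cons (_ : [set w | _] = [set w | b i w] `|` [set w | has (b^~ w) s]).
  by split; [exact: measurableU|rewrite (le_trans (measureU2 _ _ _))// leeD2l].
by apply/seteqP; split=> w /= => [/orP|[]->]; rewrite ?orbT.
Qed.

Section hommel_bound.
Context {R : realType} {d : measure_display} {Omega : measurableType d}.
Context {P : probability Omega R} {n : nat} (rho : R) (X : 'I_n -> {RV P >-> R}).
Hypotheses (rho_gt0 : 0 < rho) (rho_lt1 : rho < 1).
Hypothesis hX : equicorrelated_normal (fun=> 0) rho X.
Variables (alpha K z l B T : R).
Hypotheses (alpha_gt0 : 0 < alpha) (zP : alpha < pvalue z).
Hypotheses (l_gt0 : 0 < l) (B_gt0 : 0 < B) (T_ge0 : 0 <= T).
Hypothesis TP : alpha * B / n%:R < normal_pdf 0 1 (T + 1).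

Let p w i := pvalue (X i w).

(** The deterministic core: more than n / B p-values exceed [alpha], so a rejected one would be
    below [alpha * B / n%:R], while every [X j w] is at most [T]. *)
Lemma hommel_no_rejection w i :
  lincomb X (mean_coef (n := n)) w < K ->
  expR (l * (K - z)) + 2 <= exp_mean X (- l) w ->
  exp_mean X (- (2 * l)) w < B ->
  (forall j, lincomb X (dev_coef j) w < T - K) ->
  i \notin hommel alpha (p w).
Proof.
move=> MK A1 A2 YT; set u0 := expR (l * (K - z)) in A1.
have n0 : 0 < n%:R :> R by rewrite ltr0n (leq_ltn_trans _ (ltn_ord i)).
pose u j := expR (lincomb X (fun k => - l * dev_coef j k) w).
have XE j : X j w = lincomb X (dev_coef j) w + lincomb X (mean_coef (n := n)) w.
  by rewrite dev_lincombE subrK.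
pose S := [set j | (alpha < p w j)%R]%SET.
(* Truncation in place of Cauchy-Schwarz: [u j] is at most [u0], or lies between [u0] and [B] with
   [j] in [S], or exceeds [B] and is at most [u j ^+ 2 / B]. Averaging over [j] leaves more than 1
   for the middle term. *)
have uS j : u j <= u0 + B * (j \in S)%:R + u j ^+ 2 / B.
  have u2 : 0 <= u j ^+ 2 / B by rewrite divr_ge0 ?sqr_ge0 ?ltW.
  have [uu0|u0u] := leP (u j) u0.
    have : 0 <= B * (j \in S)%:R by apply: mulr_ge0; [exact: ltW|exact: ler0n].
    by lra.
  have jS : j \in S.
    rewrite inE (lt_le_trans zP)// pvalue_nonincreasing//.
    move: u0u; rewrite /u -lincombZ ltr_expR mulNr -mulrN ltr_pM2l// XE; lra.
  rewrite jS mulr1; have u00 : 0 < u0 by exact: expR_gt0.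
  have [uB|Bu] := leP (u j) B; first by lra.
  have h : u j <= u j ^+ 2 / B.
    by rewrite ler_pdivlMr// expr2 ler_pM2l ?expR_gt0// ltW.
  by move: h u00 B_gt0; lra.
have cS : \sum_j (j \in S)%:R = #|S|%:R :> R.
  by rewrite -sum1_card natr_sum [RHS]big_mkcond; apply: eq_bigr => j _; case: ifP.
have A1le : exp_mean X (- l) w <=
    u0 + B * (#|S|%:R / n%:R) + exp_mean X (- (2 * l)) w / B.
  have -> : exp_mean X (- (2 * l)) w = n%:R^-1 * \sum_j u j ^+ 2.
    congr (_ * _); apply: eq_bigr => j _.
    by rewrite /u -expRM_natl -!lincombZ; congr expR; ring.
  rewrite /exp_mean mulrC ler_pdivrMr//.
  apply: (le_trans (ler_sum _ (fun j _ => uS j))).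
  rewrite !big_split/= sumr_const card_ord -mulr_sumr -mulr_suml cS.
  rewrite le_eqVlt; apply/orP; left; apply/eqP.
  by rewrite -[u0 *+ n]mulr_natr; field; rewrite !gt_eqF.
have NB : 1 < B * (#|S|%:R / n%:R).
  have : exp_mean X (- (2 * l)) w / B < 1 by rewrite ltr_pdivrMr// mul1r.
  by lra.
have S0 : (0 < #|S|)%N.
  by rewrite lt0n; apply: contraTN NB => /eqP ->; rewrite mul0r mulr0 ltr10.
apply/negP => /(hommel_rejection alpha_gt0 S0); apply/negP; rewrite -ltNge.
have XT : X i w <= T by rewrite XE; have := YT i; lra.
apply: lt_le_trans (pvalue_ge_pdf T_ge0 XT); apply: le_lt_trans TP.
rewrite -mulrA ler_pM2l// -[leLHS]mul1r ler_pdivrMr ?ltr0n//.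
by rewrite mulrAC -mulrA ltW.
Qed.

Hypothesis n_gt0 : (0 < n)%N.
Hypothesis lP :
  2 * (expR (l * (K - z)) + 2) <= expR (l ^+ 2 * ((1 - rho) * (1 - n%:R^-1)) / 2).
Hypothesis KT : K < T.

(** The four terms bound, in order, the probabilities of the bad events [E1] to [E4], outside which
    nothing is rejected. *)
Lemma FWER_hommel_bound :
  (FWER (fun=> 0%R) X (@hommel R n) alpha <=
   (expR (2^-1 - K) + 4 * expR (l ^+ 2) / n%:R + expR (2 * l ^+ 2) / B +
    n%:R * expR (- ((T - K) ^+ 2 / (2 * (1 - rho)))))%:E)%E.
Proof.
pose m := expR ((- l) ^+ 2 * ((1 - rho) * (1 - n%:R^-1)) / 2).
pose E1 := [set w | K <= lincomb X (mean_coef (n := n)) w].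
pose E2 := [set w | exp_mean X (- l) w <= m / 2].
pose E3 := [set w | B <= exp_mean X (- (2 * l)) w].
pose E4 := [set w | has (fun i => T - K <= lincomb X (dev_coef i) w) (enum 'I_n)].
have mE1 : measurable E1 by exact: measurable_ge_cst.
have mE2 : measurable E2 by apply: measurable_le_cst; exact: measurable_exp_mean.
have mE3 : measurable E3 by apply: measurable_ge_cst; exact: measurable_exp_mean.
have [mE4 PE4] := @measure_has_le _ _ _ P _ (enum 'I_n)
  (fun i w => T - K <= lincomb X (dev_coef i) w)
  (fun i => measurable_ge_cst _ (@measurable_funPT _ _ _ _ (lincomb X (dev_coef i)))).
rewrite -/E4 in mE4 PE4.
have sub : [set w | (1 <= type1_errors (fun=> 0%R : R) (hommel alpha (p w)))%N] `<=`
    E1 `|` E2 `|` E3 `|` E4.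
  move=> w /= /card_gt0P[i]; rewrite !inE => /andP[ih _].
  apply: contrapT => /not_orP[/not_orP[/not_orP[/negP M1 /negP M2] /negP M3] /negP M4].
  move: ih; apply/negP; apply: hommel_no_rejection.
  - by rewrite ltNge.
  (* [m] is the expectation of [exp_mean X (- l)]; [lP] says that half of it reaches the level
     required. *)
  - have {}M2 : m / 2 < exp_mean X (- l) w by rewrite ltNge.
    apply: le_trans (ltW M2); rewrite ler_pdivlMr// mulrC.
    by rewrite /m sqrrN.
  - by rewrite ltNge.
  - move=> j; rewrite ltNge.
    by move/hasPn : M4; apply; rewrite mem_enum.
have mE12 := measurableU _ _ mE1 mE2; have mE123 := measurableU _ _ mE12 mE3.
have mE := measurableU _ _ mE123 mE4.
apply: (@le_trans _ _ (P (E1 `|` E2 `|` E3 `|` E4))).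
  by apply: le_measure; rewrite ?inE//; exact: measurable_hommel_errors.
rewrite !EFinD; apply: (le_trans (measureU2 _ mE123 mE4)); apply: leeD.
  apply: (le_trans (measureU2 _ mE12 mE3)); apply: leeD.
    apply: (le_trans (measureU2 _ mE1 mE2)); apply: leeD.
      exact: (mean_tail rho_lt1 hX n_gt0).
    have := exp_mean_lower_tail rho_gt0 rho_lt1 hX n_gt0 (- l).
    by rewrite /E2 /m sqrrN.
  have := exp_mean_upper_tail rho_gt0 rho_lt1 hX n_gt0 (- (2 * l)) B_gt0.
  by rewrite (_ : (- (2 * l)) ^+ 2 / 2 = 2 * l ^+ 2)//; field.
apply: (le_trans PE4).
apply: (@le_trans _ _ (\sum_(i <- enum 'I_n)
    (expR (- ((T - K) ^+ 2 / (2 * (1 - rho)))))%:E)%E).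
  apply: lee_sum => i _; apply: (dev_tail rho_lt1 hX n_gt0).
  by rewrite subr_gt0.
by rewrite big_enum/= sumEFin sumr_const card_ord -[X in (X%:E <= _)%E]mulr_natl.
Qed.

End hommel_bound.

(** * Choice of the constants and of the threshold *)

Section asymptotics.
Context {R : realType}.
Implicit Types (a b c k e L : R).

Lemma exists_gaussian_gt_exp a b : 0 < a ->
  exists2 l : R, 0 < l & 2 * (expR (l * b) + 2) <= expR (a * l ^+ 2).
Proof.
move=> a0; have b0 := normr_ge0 b; set l := (`|b| + 5) / a + 1.
have l1 : 1 <= l by rewrite lerDr divr_ge0 ?ltW//; lra.
have al : `|b| + 5 <= a * l.
  by rewrite mulrDr mulr1 mulrCA divff ?gt_eqF// mulr1 lerDl ltW.
exists l; first by lra.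
have lb : l * b <= l * `|b| by rewrite ler_wpM2l ?ler_norm//; lra.
have h : l * `|b| + 5 <= a * l ^+ 2 by nra.
apply: (@le_trans _ _ (expR (l * `|b| + 5))); last by rewrite ler_expR.
have e1 : expR (l * b) <= expR (l * `|b|) by rewrite ler_expR.
have e2 : 1 <= expR (l * `|b|) by rewrite -expR0 ler_expR mulr_ge0//; lra.
have e5 : 1 + 5 <= expR 5 :> R by exact: expR_ge1Dx.
rewrite expRD; nra.
Qed.

(* [L] solves [n * k = exp (L ^ 2 / 2)]; then [n] times a Gaussian tail of smaller
   variance [c^-1 < 1] at [L - b] vanishes. *)
Lemma gaussian_threshold k b c e L0 : 0 < k -> 1 < c -> 0 < e ->
  exists N : nat, forall n, (N <= n)%N -> exists L,
    [/\ L0 <= L, n%:R * k = expR (L ^+ 2 / 2) &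
        n%:R * expR (- (c * (L - b) ^+ 2 / 2)) <= e].
Proof.
move=> k0 c1 e0.
(* One summand per requirement: [L0 <= L], then [2 * c * |b| + 2 <= (c - 1) * L], then
   [- L <= ln (k * e)]. *)
pose L1 := `|L0| + (2 * c * `|b| + 2) / (c - 1) + `|ln (k * e)|.
have c10 : 0 < c - 1 by lra.
have b0 := normr_ge0 b.
have q0 : 0 <= (2 * c * `|b| + 2) / (c - 1).
  by rewrite divr_ge0 ?ltW//; nra.
have L10 : 0 <= L1 by rewrite !addr_ge0.
exists (Num.bound (expR (L1 ^+ 2 / 2) / k)) => n Nn.
have nL1 : expR (L1 ^+ 2 / 2) <= n%:R * k.
  rewrite -ler_pdivrMr//; apply: (@le_trans _ _ (Num.bound (expR (L1 ^+ 2 / 2) / k))%:R).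
    by apply: ltW; apply: archi_boundP; rewrite divr_ge0 ?expR_ge0 ?ltW.
  by rewrite ler_nat.
have nk0 : 0 < n%:R * k by exact: lt_le_trans (expR_gt0 _) nL1.
have lnL1 : L1 ^+ 2 / 2 <= ln (n%:R * k) by rewrite -ler_expR lnK.
pose L := Num.sqrt (2 * ln (n%:R * k)).
have L2 : L ^+ 2 = 2 * ln (n%:R * k).
  rewrite sqr_sqrtr//; have := sqr_ge0 L1; lra.
have LL1 : L1 <= L.
  by rewrite -(@ler_pXn2r _ 2)// ?nnegrE ?sqrtr_ge0// L2; lra.
have nE : n%:R * k = expR (L ^+ 2 / 2).
  by rewrite (_ : L ^+ 2 / 2 = ln (n%:R * k)) ?lnK// L2; lra.
exists L; split=> //.
  apply: le_trans LL1; apply: (le_trans (ler_norm L0)).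
  by rewrite /L1 -addrA lerDl addr_ge0.
(* In logarithms the claim is [L ^+ 2 / 2 - c * (L - b) ^+ 2 / 2 <= ln (k * e)]; the left side is
   shown to be at most [- L]. *)
rewrite -(ler_pM2r k0) mulrAC nE -expRD.
have -> : e * k = expR (ln (k * e)) by rewrite lnK 1?mulrC// posrE mulr_gt0.
rewrite ler_expR.
have Lq : (2 * c * `|b| + 2) <= (c - 1) * L.
  rewrite [leRHS]mulrC -ler_pdivrMr//; apply: le_trans LL1.
  by rewrite /L1 -addrA addrCA lerDl addr_ge0.
have Lln : - L <= ln (k * e).
  rewrite lerNl; apply: le_trans LL1; rewrite (le_trans (ler_norm _))// normrN.
  by rewrite /L1 lerDr addr_ge0.
apply: le_trans Lln.
have bb : b <= `|b| by exact: ler_norm.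
have L0' : 0 <= L by exact: sqrtr_ge0.
have h1 : 2 * c * (L * b) <= 2 * c * (L * `|b|).
  by rewrite ler_wpM2l ?ler_wpM2l//; lra.
have h2 : (2 * c * `|b| + 2) * L <= (c - 1) * L * L by rewrite ler_wpM2r.
have h3 : 0 <= c * b ^+ 2 by rewrite mulr_ge0 ?sqr_ge0//; lra.
by lra.
Qed.

End asymptotics.

Theorem theorem5p2 (R : realType) (rho : R) (hrho0 : 0 < rho) (hrho1 : rho < 1)
  (d : nat -> measure_display) (Omega : forall n : nat, measurableType (d n))
  (P : forall n : nat, probability (Omega n) R)
  (mu : forall n : nat, 'I_n -> R)
  (X : forall n : nat, 'I_n -> {RV (P n) >-> R})
  (hX : forall n : nat, equicorrelated_normal (mu n) rho (X n))
  (global_null : forall (n : nat) (i : 'I_n), mu n i = 0)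
  (alpha : R) (halpha0 : 0 < alpha) (halpha1 : alpha < 1) :
  FWER (mu n) (X n) (@hommel R n) alpha @[n --> \oo] --> (0 : \bar R)%E.
Proof.
have mu0 n : mu n = fun=> 0 by apply/funext => i; rewrite global_null.
have FWER_ge0 n : (0 <= FWER (mu n) (X n) (@hommel R n) alpha)%E by exact: measure_ge0.
(* Bounds in the extended reals suffice: the case [e = 1] makes the rate eventually finite, and
   [fine] then converges. *)
suff small e : 0 < e -> \forall n \near \oo,
    (FWER (mu n) (X n) (@hommel R n) alpha <= e%:E)%E.
  apply/fine_cvgP; split.
    near=> n; rewrite ge0_fin_numE//.
    by apply: (@le_lt_trans _ _ 1%E); [near: n; exact: small|exact: ltry].
  apply/cvgrPdist_le => e e0; near=> n.
  rewrite sub0r normrN ger0_norm ?fine_ge0//.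
  have Fe : (FWER (mu n) (X n) (@hommel R n) alpha <= e%:E)%E by near: n; exact: small.
  by rewrite -lee_fin fineK// ge0_fin_numE// (le_lt_trans Fe)// ltry.
move=> e0.
have q0 : 0 < e / 4 by rewrite divr_gt0.
have r0 : 0 < 1 - rho by rewrite subr_gt0.
(* Each of the four terms gets [e / 4]. The constants are fixed before [n], in the order [K], [z],
   [l], [B], [k]. *)
pose K := 2^-1 - ln (e / 4).
have KE : expR (2^-1 - K) = e / 4 by rewrite /K opprB addrC subrK lnK.
have [z zP] := exists_pvalue_gt halpha1.
(* The 4 arises from [1 - n%:R^-1 >= 2^-1], whence [2 <= n] below. *)
have [l l0 lP] := @exists_gaussian_gt_exp R ((1 - rho) / 4) (K - z)
  ltac:(by rewrite divr_gt0).
have [B B0 BE] : exists2 B, 0 < B & expR (2 * l ^+ 2) / B = e / 4.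
  exists (expR (2 * l ^+ 2) / (e / 4)); first by rewrite divr_gt0// expR_gt0.
  by rewrite [X in _ * X]invf_div mulrCA divff ?mulr1// gt_eqF// expR_gt0.
have peak0 : 0 < normal_peak (1 : R) by rewrite normal_peak_gt0// oner_eq0.
(* With this [k], [normal_pdf 0 1 L] equals [2 * alpha * B / n%:R]; the 2 makes [TP] strict. *)
pose k := normal_peak 1 / (2 * (alpha * B)).
have k0 : 0 < k by rewrite divr_gt0// !mulr_gt0.
(* Positivity of [rho] gives [(1 - rho)^-1 > 1]. With [T = L - 1], the shift [T - K] is
   [L - (1 + K)], and [2 + |K| <= L] ensures [0 <= T] and [K < T]. *)
have [N1 N1P] := @gaussian_threshold R k (1 + K) (1 - rho)^-1 (e / 4)
  (2 + `|K|) k0 ltac:(by rewrite invf_gt1//; lra) q0.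
pose N2 := Num.bound (4 * expR (l ^+ 2) / (e / 4)).
exists (maxn 2 (maxn N1 N2)) => // n /=; rewrite !geq_max => /and3P[n2 nN1 nN2].
have [L [L0 nk Ltail]] := N1P n nN1.
have n0 : 0 < n%:R :> R by rewrite ltr0n (leq_trans _ n2).
have K0 := normr_ge0 K; have KK := ler_norm K.
rewrite mu0.
have hX0 : equicorrelated_normal (fun=> 0) rho (X n) by rewrite -mu0.
apply: (@le_trans _ _ _ _ _ (@FWER_hommel_bound _ _ _ _ _ _ _ hrho0 hrho1 hX0
  alpha K z l B (L - 1) halpha0 zP l0 B0 _ _ _ _ _)).
- by lra.
- rewrite subrK normal_pdfE ?oner_eq0// /normal_fun subr0 expr1n mulNr expRN.
  rewrite -nk -[normal_peak 1](_ : 2 * (alpha * B) * k = _); last first.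
    by rewrite /k mulrC divfK// gt_eqF// !mulr_gt0.
  have -> : 2 * (alpha * B) * k / (n%:R * k) = 2 * (alpha * B) / n%:R.
    by field; rewrite !gt_eqF.
  rewrite ltr_pM2r ?invr_gt0//.
  have : 0 < alpha * B by rewrite mulr_gt0.
  by lra.
- by rewrite (leq_trans _ n2).
- apply: (le_trans lP); rewrite ler_expR.
  have n12 : n%:R^-1 <= 2^-1 :> R by rewrite lef_pV2 ?posrE ?(ler_nat _ 2).
  have := mulr_ge0 (ltW r0) (sqr_ge0 l); nra.
- by lra.
rewrite lee_fin KE BE.
have -> : - ((L - 1 - K) ^+ 2 / (2 * (1 - rho))) =
    - ((1 - rho)^-1 * (L - (1 + K)) ^+ 2 / 2) by field; rewrite gt_eqF.
have : 4 * expR (l ^+ 2) / n%:R <= e / 4.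
  rewrite ler_pdivrMr// [leRHS]mulrC -ler_pdivrMr//.
  apply: (@le_trans _ _ N2%:R); last by rewrite ler_nat.
  by apply/ltW/archi_boundP; rewrite divr_ge0 ?mulr_ge0 ?expR_ge0// ltW.
by lra.
Unshelve. all: by end_near. Qed.
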